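(* Let $G$ be a regular Lie group with Lie algebra $\mathfrak g=\mathbf T_eG$. For all $X,Y\in\mathfrak g$ and all $d_1,d_2,d_3\in D$, $$\exp\big((d_1+d_2+d_3)X\big).\exp\big((d_1+d_2+d_3)Y\big)$$ $$=\exp\Big((d_1+d_2+d_3)(X+Y)+(d_1d_2+d_1d_3+d_2d_3)[X,Y]+\frac12d_1d_2d_3[X-Y,[X,Y]]\Big)$$ $$=\exp\Big((d_1+d_2+d_3)X+(d_1+d_2+d_3)Y+\frac{(d_1+d_2+d_3)^2}{2}[X,Y]+\frac{(d_1+d_2+d_3)^3}{12}[X-Y,[X,Y]]\Big).$$
   Context: We work in synthetic differential geometry. $\mathbb R$ is the line: a commutative ring in which positive integers are invertible, satisfying the (general) Kock-Lawvere axiom. $D=\{d\in\mathbb R\mid d^2=0\}$. A space $M$ is microlinear if every finite diagram of infinitesimal spaces that $\mathbb R$ perceives as a colimit is also perceived as a colimit by $M$. A Lie group is a group which is microlinear as a space; its unit is $e$ and its product is written with a dot. $\mathfrak g=\mathbf T_eG$ is the set of maps $X:D\to G$, $d\mapsto X_d$, with $X_0=e$; it is an $\mathbb R$-module with $(\alpha X)_d=X_{\alpha d}$ and $(X+Y)_d=X_d.Y_d=Y_d.X_d$, and a Lie algebra whose bracket $[X,Y]$ is the unique element of $\mathfrak g$ with $X_{d_1}.Y_{d_2}.X_{-d_1}.Y_{-d_2}=[X,Y]_{d_1d_2}$ for all $d_1,d_2\in D$. A Lie group $G$ is regular if for every map $\varsigma:\mathbb R\to\mathfrak g$ there is a map $\theta:\mathbb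 R\to G$ with $\theta(0)=e$ and $\theta(t+d)=\theta(t).\varsigma(t)_d$ for all $t\in\mathbb R$, $d\in D$. For $X\in\mathfrak g$, if $\theta:\mathbb R\to G$ is a one-parameter subgroup (a homomorphism from the additive group of $\mathbb R$) with $\theta(d)=X_d$ for all $d\in D$, then $\exp X$ denotes $\theta(1)$; when $G$ is regular, $\exp:\mathfrak g\to G$ is a total function. *)

(* Defs.v *)
(* The Kock-Lawvere axiom refutes excluded middle and decidability of equality
   on a nontrivial line.  Rings are therefore taken with plain Leibniz equality
   ([ring_theory]) and no classical axiom is used: in a ring hierarchy built on
   types with decidable equality, every line would be the zero ring. *)
From Stdlib Require Import Ring_theory Ring List Fin.

Set Implicit Arguments.
Unset Strict Implicit.
Unset Printing Implicit Defensive.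

Record comRing := ComRing {
  car :> Type;
  rzero : car;
  rone : car;
  radd : car -> car -> car;
  rmul : car -> car -> car;
  rsub : car -> car -> car;
  ropp : car -> car;
  ringP : ring_theory rzero rone radd rmul rsub ropp eq }.

Arguments rzero {c}.
Arguments rone {c}.

Declare Scope sdg_scope.
Delimit Scope sdg_scope with sdg.
Local Open Scope sdg_scope.

Notation "0" := rzero : sdg_scope.
Notation "1" := rone : sdg_scope.
Notation "x + y" := (radd x y) : sdg_scope.
Notation "x * y" := (rmul x y) : sdg_scope.
Notation "x - y" := (rsub x y) : sdg_scope.
Notation "- x" := (ropp x) : sdg_scope.

Fixpoint rexp (R : comRing) (x : R) (n : nat) : R :=
  match n with O => 1 | S m => x * rexp x m end.

Notation "x ^ n" := (rexp x n) : sdg_scope.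

Definition natr (R : comRing) (n : nat) : R := Nat.iter n (radd 1) 0.

Record is_rmorph (A B : comRing) (f : A -> B) : Prop := IsRmorph {
  rmorph1 : f 1 = 1;
  rmorphD : forall x y, f (x + y) = f x + f y;
  rmorphM : forall x y, f (x * y) = f x * f y }.

Record algebra (R : comRing) := Algebra {
  aring :> comRing;
  scal : R -> aring;
  scalP : is_rmorph scal }.

(* Spec_R W: the space of R-algebra homomorphisms W -> R. *)
Record spec (R : comRing) (W : algebra R) := Spec {
  pt :> W -> R;
  pt_morph : is_rmorph pt;
  pt_scal : forall a : R, pt (scal W a) = a }.

Definition rprod (R : comRing) (l : list R) : R := fold_right (@rmul R) 1 l.

Definition lincomb (R : comRing) (W : algebra R) (b : list R) (e : list W) : W :=
  fold_right (fun p w => scal W (fst p) * snd p + w) 0 (combine b e).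

(* W = R (+) m, with m (the kernel of the augmentation pi) a nilpotent ideal
   which is free of finite rank as an R-module. *)
Definition is_weil (R : comRing) (W : algebra R) : Prop :=
  exists pi : spec W,
    (exists k : nat, forall l : list W,
        length l = k -> (forall w, In w l -> pi w = 0) -> rprod l = 0)
    /\
    (exists e : list W,
        (forall w, In w e -> pi w = 0) /\
        (forall w, pi w = 0 ->
           exists! b : list R, length b = length e /\ w = lincomb b e)).

Record weil (R : comRing) := Weil {
  walg :> algebra R;
  walgP : is_weil walg }.

(* The canonical algebra map W -> R^(Spec_R W) is bijective, for every W. *)
Definition kock_lawvere (R : comRing) : Prop :=
  forall (W : weil R) (f : spec W -> R),
  exists! w : W, forall x : spec W, f x = x w.

(* [invn n] is the inverse of n; its value at n = 0 is irrelevant. *)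
Record line := Line {
  lring :> comRing;
  invn : nat -> lring;
  invnP : forall n, natr lring (S n) * invn (S n) = 1;
  lineKL : kock_lawvere lring }.

Arguments invn {l}.

(* A finite graph of infinitesimal spaces (spectra of Weil algebras) together
   with a cocone on it; composites of arrows impose no further condition on
   cones and cocones. *)
Record cocone (R : comRing) := Cocone {
  nobj : nat;
  narr : nat;
  src : Fin.t narr -> Fin.t nobj;
  tgt : Fin.t narr -> Fin.t nobj;
  obj : Fin.t nobj -> weil R;
  arr : forall a, spec (obj (src a)) -> spec (obj (tgt a));
  apex : weil R;
  leg : forall i, spec (obj i) -> spec apex;
  cocone_comm : forall a x, leg (arr (a := a) x) = leg x }.

(* The comparison map from M^apex to the limit of the M^(obj i) is bijective. *)
Definition perceives_colimit (R : comRing) (M : Type) (K : cocone R) : Prop :=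
  forall f : forall i, spec (obj (c := K) i) -> M,
    (forall (a : Fin.t (narr K)) x, f _ (arr (a := a) x) = f _ x) ->
  exists! g : spec (apex K) -> M, forall i x, g (leg (i := i) x) = f i x.

Definition microlinear (R : comRing) (M : Type) : Prop :=
  forall K : cocone R, perceives_colimit R K -> perceives_colimit M K.

Record D (R : comRing) := InD {
  dval :> R;
  dvalP : dval ^ 2 = 0 }.

Section DOperations.
Variable R : comRing.
Add Ring Rring : (ringP R).

Lemma Dscale_subproof (a : R) (d : D R) : (a * d) ^ 2 = 0.
Proof.
pose proof (dvalP d) as H; simpl in *.
transitivity (a * a * (d * (d * 1))); [ring | rewrite H; ring].
Qed.

Definition Dscale (a : R) (d : D R) : D R := InD (Dscale_subproof a d).

Lemma Dopp_subproof (d : D R) : (- d) ^ 2 = 0.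
Proof.
pose proof (dvalP d) as H; simpl in *.
transitivity (d * (d * 1)); [ring | exact H].
Qed.

Definition Dopp (d : D R) : D R := InD (Dopp_subproof d).

Lemma Dscale0 (a : R) (d : D R) : (d : R) = 0 -> a * d = 0.
Proof. intros ->; ring. Qed.

Lemma Dopp0 (d : D R) : (d : R) = 0 -> - d = 0.
Proof. intros ->; ring. Qed.

End DOperations.

Record lieGroup (R : line) := LieGroup {
  gcar :> Type;
  gone : gcar;
  gmul : gcar -> gcar -> gcar;
  ginv : gcar -> gcar;
  gmulA : forall x y z, gmul x (gmul y z) = gmul (gmul x y) z;
  gmul1l : forall x, gmul gone x = x;
  gmul1r : forall x, gmul x gone = x;
  gmulVl : forall x, gmul (ginv x) x = gone;
  gmulVr : forall x, gmul x (ginv x) = gone;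
  gmicro : microlinear R gcar }.

Arguments gone {R l}.

Notation "x ** y" := (gmul x y) (at level 40, left associativity) : sdg_scope.

(* X_0 = e is required at every element of D whose underlying scalar is 0, so
   that no proof irrelevance is needed for the operations below. *)
Record lie (R : line) (G : lieGroup R) := Tangent {
  tmap :> D R -> G;
  tmap0 : forall d : D R, (d : R) = 0 -> tmap d = gone }.

Section LieOperations.
Variables (R : line) (G : lieGroup R).

Lemma tadd_subproof (X Y : lie G) (d : D R) :
  (d : R) = 0 -> X d ** Y d = gone.
Proof. intros H; rewrite (tmap0 X H), (tmap0 Y H); apply gmul1l. Qed.

Definition tadd (X Y : lie G) : lie G := Tangent (tadd_subproof X Y).

Definition tscale (a : R) (X : lie G) : lie G :=
  Tangent (fun d H => tmap0 X (d := Dscale a d) (Dscale0 a H)).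

Definition topp (X : lie G) : lie G :=
  Tangent (fun d H => tmap0 X (d := Dopp d) (Dopp0 H)).

End LieOperations.

Notation "X :+ Y" := (tadd X Y) (at level 50, left associativity) : sdg_scope.
Notation "X :- Y" := (tadd X (topp Y)) (at level 50, left associativity) : sdg_scope.
Notation "a *: X" := (tscale a X) (at level 40, no associativity) : sdg_scope.

Definition is_lie_bracket (R : line) (G : lieGroup R)
    (br : lie G -> lie G -> lie G) : Prop :=
  forall X Y : lie G,
    unique (fun Z : lie G => forall d1 d2 : D R,
              X d1 ** Y d2 ** X (Dopp d1) ** Y (Dopp d2) = Z (Dscale d1 d2))
           (br X Y).

Definition regular (R : line) (G : lieGroup R) : Prop :=
  forall s : R -> lie G, exists theta : R -> G,
    theta 0 = gone /\
    forall (t : R) (d : D R), theta (t + d) = theta t ** s t d.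

Definition one_parameter_subgroup (R : line) (G : lieGroup R)
    (theta : R -> G) : Prop :=
  forall s t : R, theta (s + t) = theta s ** theta t.

(* The defining property of exp, as a total function on the Lie algebra.  It
   makes theta 1 depend on X only, as the notation "exp X" presupposes. *)
Definition is_exp (R : line) (G : lieGroup R) (exp : lie G -> G) : Prop :=
  forall (X : lie G) (theta : R -> G),
    one_parameter_subgroup theta -> (forall d : D R, theta d = X d) ->
    exp X = theta 1.

(* Main.v *)
(* Microlinearity is used for one colimit only: D(2) is the pushout of two
   copies of D over a point, whence X_(d+d') = X_d . X_d' when d, d' and d+d'
   lie in D.  The rest is group theory based on
   X_d . Y_d' = [X,Y]_(dd') . Y_d' . X_d, where X_d and Y_d' commute if dd' = 0.

   Write s2 = d1d2 + d1d3 + d2d3 and s3 = d1d2d3.  All the exponentials involved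
   are values at 1 of explicit one-parameter subgroups:
     t |-> X_(t d1) . X_(t d2) . X_(t d3)   for (d1+d2+d3) X, and
     t |-> A_(t d1) . A_(t d2) . A_(t d3) . B_(t s2) . [A,B]_(-3/2 t^2 s3) . C_(t c s3)
   for (d1+d2+d3) A + s2 B + c s3 C; the factor quadratic in t compensates the
   failure of the curves for A and B to commute.  With A = X+Y, B = [X,Y] and
   C = [X-Y,B], the first equation becomes an identity between words in the X_di,
   Y_di and B_(di dj), proved by moving each Y_di to the left of X_dj for j > i. *)
Require Import Defs.
From Stdlib Require Import Ring List Fin FunctionalExtensionality ProofIrrelevance.
Import ListNotations.
Local Open Scope sdg_scope.

Set Implicit Arguments.
Unset Strict Implicit.

(** * Extensionality for points of [D], points of spectra and tangent vectors *)

Lemma D_ext (R : comRing) (d d' : D R) : (d : R) = d' -> d = d'.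
Proof.
destruct d as [d p], d' as [d' q]; cbn; intros <-.
now rewrite (proof_irrelevance _ p q).
Qed.

Lemma spec_ext (R : comRing) (W : algebra R) (x y : spec W) :
  (forall w, x w = y w) -> x = y.
Proof.
destruct x as [x p q], y as [y p' q']; cbn; intros E.
apply functional_extensionality in E; subst y.
now rewrite (proof_irrelevance _ p p'), (proof_irrelevance _ q q').
Qed.

Lemma lie_ext (R : line) (G : lieGroup R) (X Y : lie G) :
  (forall d, X d = Y d) -> X = Y.
Proof.
destruct X as [X p], Y as [Y q]; cbn; intros E.
apply functional_extensionality in E; subst Y.
now rewrite (proof_irrelevance _ p q).
Qed.

(** * D(2) as the pushout of its two axes *)

Section SquareZero.
Variable R : comRing.
Add Ring Rring : (ringP R).

(* R[e1, e2] / (e1, e2)^2, whose spectrum is D(2). *)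
Ltac triple_ring := cbn; repeat apply (f_equal2 pair); ring.

Definition sqz_car : Type := (R * R * R)%type.

Lemma sqz_ringP : @ring_theory sqz_car (0, 0, 0) (1, 0, 0)
  (fun '(a, b, c) '(a', b', c') => (a + a', b + b', c + c'))
  (fun '(a, b, c) '(a', b', c') => (a * a', a * b' + b * a', a * c' + c * a'))
  (fun '(a, b, c) '(a', b', c') => (a - a', b - b', c - c'))
  (fun '(a, b, c) => (- a, - b, - c)) eq.
Proof.
constructor; intros; unfold sqz_car in *;
  repeat match goal with u : (_ * _)%type |- _ => destruct u end;
  triple_ring.
Qed.

Definition sqz_ring : comRing := ComRing sqz_ringP.

Lemma sqz_scalP : @is_rmorph R sqz_ring (fun a => (a, 0, 0)).
Proof. constructor; intros; cbn; triple_ring. Qed.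

Definition sqz_alg : algebra R := Algebra sqz_scalP.

Definition sqz_eval (u v : R) (w : sqz_alg) : R :=
  let '(a, b, c) := w in a + b * u + c * v.

Lemma sqz_eval_morph (u v : R) :
  u * u = 0 -> v * v = 0 -> u * v = 0 -> is_rmorph (sqz_eval u v).
Proof.
intros Hu Hv Huv; constructor.
- cbn; ring.
- intros [[a b] c] [[a' b'] c']; cbn; ring.
- intros [[a b] c] [[a' b'] c']; cbn.
  transitivity ((a + b * u + c * v) * (a' + b' * u + c' * v)
    - (b * b') * (u * u) - (c * c') * (v * v) - (b * c' + c * b') * (u * v)).
  + ring.
  + rewrite Hu, Hv, Huv; ring.
Qed.

Lemma sqz_eval_scal (u v a : R) : sqz_eval u v (scal sqz_alg a) = a.
Proof. cbn; ring. Qed.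

Definition sqz_pt (u v : R) (Hu : u * u = 0) (Hv : v * v = 0) (Huv : u * v = 0) :
  spec sqz_alg := Spec (sqz_eval_morph Hu Hv Huv) (sqz_eval_scal u v).

Definition sqz_e1 : sqz_alg := (0, 1, 0).
Definition sqz_e2 : sqz_alg := (0, 0, 1).

Lemma pt_sqz (x : spec sqz_alg) (a b c : R) :
  x (a, b, c) = a + b * x sqz_e1 + c * x sqz_e2.
Proof.
pose proof (pt_morph x) as Hx.
rewrite <- (pt_scal x a) at 2; rewrite <- (pt_scal x b) at 2;
  rewrite <- (pt_scal x c) at 2.
rewrite <- !(rmorphM Hx), <- !(rmorphD Hx); f_equal.
cbn; triple_ring.
Qed.

Lemma zero_mul : (0 : R) * 0 = 0.
Proof. ring. Qed.

(** The augmentation is evaluation at the origin; its kernel has square zero and basis [sqz_e1],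
    [sqz_e2]. *)
Lemma sqz_weilP : is_weil sqz_alg.
Proof.
exists (sqz_pt zero_mul zero_mul zero_mul).
assert (aug : forall a b c : R, a + b * 0 + c * 0 = 0 -> a = 0).
{ intros a b c H; transitivity (a + b * 0 + c * 0); [ring | exact H]. }
split.
- exists 2; intros [|[[a b] c] [|[[a' b'] c'] [|]]]; try discriminate; intros _ H.
  pose proof (aug _ _ _ (H _ (or_introl eq_refl))) as E.
  pose proof (aug _ _ _ (H _ (or_intror (or_introl eq_refl)))) as E'.
  subst a a'; cbn; triple_ring.
- exists [sqz_e1; sqz_e2]; split.
  + intros w [<- | [<- | []]]; cbn; ring.
  + intros [[a b] c] H; apply aug in H; subst a.
    exists [b; c]; split.
    * split; [reflexivity | cbn; triple_ring].
    * intros [|b' [|c' [|]]] [L E]; try discriminate.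
      cbn in E; injection E; intros Ec Eb _.
      rewrite Eb, Ec; f_equal; [ring | f_equal; ring].
Qed.

Definition sqz_weil : weil R := Weil sqz_weilP.

(** On spectra this induces (u, v) |-> (iu, jv). *)
Definition dil (i j : R) (w : sqz_alg) : sqz_alg :=
  let '(a, b, c) := w in (a, i * b, j * c).

Lemma dil_morph (i j : R) (x : spec sqz_alg) :
  is_rmorph (fun w => x (dil i j w)).
Proof.
pose proof (pt_morph x) as Hx; constructor.
- rewrite <- (rmorph1 Hx); f_equal; cbn; triple_ring.
- intros [[a b] c] [[a' b'] c']; rewrite <- (rmorphD Hx); f_equal.
  cbn; triple_ring.
- intros [[a b] c] [[a' b'] c']; rewrite <- (rmorphM Hx); f_equal.
  cbn; triple_ring.
Qed.

Lemma dil_scal (i j : R) (x : spec sqz_alg) (a : R) :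
  x (dil i j (scal sqz_alg a)) = a.
Proof. rewrite <- (pt_scal x a) at 2; f_equal; cbn; triple_ring. Qed.

Definition dil_pt (i j : R) (x : spec sqz_alg) : spec sqz_alg :=
  Spec (dil_morph i j x) (dil_scal i j x).

Definition axis (k : Fin.t 3) : spec sqz_weil -> spec sqz_weil :=
  match k with
  | F1 => dil_pt 1 0
  | FS F1 => dil_pt 0 1
  | _ => dil_pt 0 0
  end.

(** The first two arrows are the idempotents of the two axes; the last two send the point to the
    origin of either axis. *)
Definition axes_src (a : Fin.t 4) : Fin.t 3 :=
  match a with
  | F1 => F1
  | FS F1 => FS F1
  | _ => FS (FS F1)
  end.

Definition axes_tgt (a : Fin.t 4) : Fin.t 3 :=
  match a with
  | F1 => F1
  | FS F1 => FS F1
  | FS (FS F1) => F1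
  | _ => FS F1
  end.

Lemma axes_comm (a : Fin.t 4) (x : spec sqz_weil) :
  axis (axes_tgt a) (axis (axes_src a) x) = axis (axes_src a) x.
Proof.
apply spec_ext; intros [[p q] r].
repeat (apply (Fin.caseS' a); clear a; [|intros a]); [.. | inversion a];
  cbn; f_equal; triple_ring.
Qed.

(* The pushout D <- 1 -> D, with D and 1 encoded as the images of the
   idempotents (u, v) |-> (u, 0), (u, v) |-> (0, v) and (u, v) |-> (0, 0) of
   D(2), so that a single Weil algebra is enough. *)
Definition axes : cocone R :=
  @Cocone R 3 4 axes_src axes_tgt (fun _ => sqz_weil) (fun a => axis (axes_src a))
    sqz_weil axis axes_comm.

(** By Kock-Lawvere and invariance under the idempotents, the functions on the axes are a1 + b1 u
    and a2 + c2 v. Agreement at the origin [o] gives a2 = a1, and they glue to a1 + b1 u + c2 v. *)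
Lemma axes_colimit : kock_lawvere R -> perceives_colimit R axes.
Proof.
intros KL f comm; cbn in f, comm.
destruct (KL sqz_weil (f F1)) as [[[a1 b1] c1] [E1 _]].
destruct (KL sqz_weil (f (FS F1))) as [[[a2 b2] c2] [E2 _]].
set (o := sqz_pt zero_mul zero_mul zero_mul).
assert (C1 := comm F1). assert (C2 := comm (FS F1)).
assert (C3 := comm (FS (FS F1))). assert (C4 := comm (FS (FS (FS F1)))).
cbn in C1, C2, C3, C4.
assert (a12 : a2 = a1).
{ pose proof (C3 o) as H; rewrite <- (C4 o), E1, E2 in H; cbn in H.
  transitivity (a2 + 0 * b2 * 0 + 0 * c2 * 0); [ring | rewrite <- H; ring]. }
subst a2.
exists (fun x : spec sqz_weil => x (a1, b1, c2)); split.
- intros i; repeat (apply (Fin.caseS' i); clear i; [|intros i]);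
    [.. | inversion i]; intros x; cbn.
  + rewrite <- C1, E1; cbn; f_equal; triple_ring.
  + rewrite <- C2, E2; cbn; f_equal; triple_ring.
  + rewrite <- C3, E1; cbn; f_equal; triple_ring.
- intros g Hg; apply functional_extensionality; intros x.
  destruct (KL sqz_weil g) as [[[a b] c] [Eg _]]; rewrite Eg.
  (* The uniqueness half of Kock-Lawvere: points separate the elements of the Weil algebra. *)
  assert (inj : forall w w' : sqz_weil, (forall y : spec sqz_weil, y w = y w') -> w = w').
  { intros w w' H; destruct (KL sqz_weil (fun y => y w)) as [v [_ Hv]].
    rewrite <- (Hv w), <- (Hv w'); auto. }
  assert (H1 : ((a1, 1 * b1, 0 * c1) : sqz_weil) = (a, 1 * b, 0 * c)).
  { apply inj; intros y; symmetry.
    generalize (Hg F1 y); rewrite Eg, <- C1, E1; cbn; intros H; exact H. }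
  assert (H2 : ((a1, 0 * b2, 1 * c2) : sqz_weil) = (a, 0 * b, 1 * c)).
  { apply inj; intros y; symmetry.
    generalize (Hg (FS F1) y); rewrite Eg, <- C2, E2; cbn; intros H; exact H. }
  injection H1; intros _ Hb Ha; injection H2; intros Hc _ _.
  f_equal; repeat f_equal.
  + exact Ha.
  + transitivity (1 * b1); [ring | rewrite Hb; ring].
  + transitivity (1 * c2); [ring | rewrite Hc; ring].
Qed.

End SquareZero.

Lemma perceived_ext (R : comRing) (M : Type) (K : cocone R)
    (g g' : spec (apex K) -> M) :
  perceives_colimit M K ->
  (forall i x, g (leg (i := i) x) = g' (leg (i := i) x)) -> g = g'.
Proof.
intros HK E.
destruct (HK (fun i x => g (leg (i := i) x))) as [h [_ Hh]].
- now intros a x; rewrite cocone_comm.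
- now rewrite <- (Hh g), <- (Hh g'); intros; rewrite ?E.
Qed.

(** * Additivity of tangent vectors along D(2) *)

Section WedgedTangents.
Variables (R : line) (G : lieGroup R).
Add Ring Rline : (ringP R).

Lemma half_half : invn 2 + invn 2 = 1 :> R.
Proof. transitivity (natr R 2 * invn 2); [cbn; ring | apply invnP]. Qed.

Lemma D_sq (d : D R) : d * d = 0.
Proof. transitivity ((d : R) ^ 2); [cbn; ring | apply dvalP]. Qed.

Lemma tmap_ext (X : lie G) (d d' : D R) : (d : R) = d' -> X d = X d'.
Proof. now intros E; rewrite (D_ext E). Qed.

Lemma sqz_D_subproof (i j : R) (x : spec (sqz_alg R)) : x (0, i, j) ^ 2 = 0.
Proof.
transitivity (x (0, i, j) * x (0, i, j)); [cbn; ring |].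
rewrite <- (rmorphM (pt_morph x)); cbn; rewrite pt_sqz; ring.
Qed.

Definition sqz_D (i j : R) (x : spec (sqz_alg R)) : D R :=
  InD (sqz_D_subproof i j x).

(** As maps on D(2), both sides agree on each axis, where one factor on the right is the unit;
    microlinearity then makes them equal. *)
Lemma tmap_sqz (X : lie G) (x : spec (sqz_alg R)) :
  X (sqz_D 1 1 x) = X (sqz_D 1 0 x) ** X (sqz_D 0 1 x).
Proof.
assert (E : (fun x : spec (apex (axes R)) => X (sqz_D 1 1 x)) =
            (fun x => X (sqz_D 1 0 x) ** X (sqz_D 0 1 x))).
{ apply perceived_ext; [exact (@gmicro R G (axes R) (axes_colimit (@lineKL R))) |].
  intros i; repeat (apply (Fin.caseS' i); clear i; [|intros i]);
    [.. | inversion i]; intros y; cbn.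
  - rewrite (@tmap0 _ _ X (sqz_D 0 1 _)), gmul1r; [apply tmap_ext |];
      cbn; rewrite ?pt_sqz; ring.
  - rewrite (@tmap0 _ _ X (sqz_D 1 0 _)), gmul1l; [apply tmap_ext |];
      cbn; rewrite ?pt_sqz; ring.
  - rewrite !tmap0, gmul1r; [reflexivity |..]; cbn; rewrite pt_sqz; ring. }
exact (f_equal (fun g => g x) E).
Qed.

Lemma tmapD (X : lie G) (d d' e : D R) : (e : R) = d + d' -> X e = X d ** X d'.
Proof.
intros E.
(* Expanding e^2 = 0 gives 2dd' = 0, so (d, d') is a point of D(2). *)
assert (dd' : d * d' = 0).
{ transitivity (invn 2 * (e * e - d * d - d' * d')).
  - rewrite E; transitivity ((invn 2 + invn 2) * (d * d'));
      [rewrite half_half |]; ring.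
  - rewrite !D_sq; ring. }
transitivity (X (sqz_D 1 1 (sqz_pt (D_sq d) (D_sq d') dd'))).
- apply tmap_ext; cbn; rewrite E; ring.
- rewrite tmap_sqz; apply f_equal2; apply tmap_ext; cbn; ring.
Qed.

Lemma tscaleD (X : lie G) (a b : R) (d : D R) :
  X (Dscale (a + b) d) = X (Dscale a d) ** X (Dscale b d).
Proof. apply tmapD; cbn; ring. Qed.

End WedgedTangents.

(** * Calculus of the Lie bracket through exchange of factors *)

Section Bracket.
Variables (R : line) (G : lieGroup R).
Variable br : lie G -> lie G -> lie G.
Hypothesis brP : is_lie_bracket br.
Add Ring Rbracket : (ringP R).

Lemma gmul_cancel_r (x y z : G) : x ** z = y ** z -> x = y.
Proof.
intros E; rewrite <- (gmul1r x), <- (gmul1r y), <- (gmulVr z), !gmulA.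
now rewrite E.
Qed.

Lemma tmapNK (X : lie G) (d : D R) : X d ** X (Dopp d) = gone.
Proof.
rewrite <- (tmapD X (e := Dscale 0 d)); [apply tmap0 |]; cbn; ring.
Qed.

Lemma tmapKN (X : lie G) (d : D R) : X (Dopp d) ** X d = gone.
Proof.
rewrite <- (tmapD X (e := Dscale 0 d)); [apply tmap0 |]; cbn; ring.
Qed.

Lemma commutator_iff (X Y Z : lie G) (d d' : D R) :
  X d ** Y d' ** X (Dopp d) ** Y (Dopp d') = Z (Dscale d d') <->
  X d ** Y d' = Z (Dscale d d') ** Y d' ** X d.
Proof.
split; intros E.
- rewrite <- E, <- !gmulA, (gmulA (Y (Dopp d'))), tmapKN, gmul1l.
  now rewrite tmapKN, gmul1r.
- rewrite E, <- !gmulA, (gmulA (X d)), tmapNK, gmul1l.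
  now rewrite tmapNK, gmul1r.
Qed.

Lemma br_swap (X Y : lie G) (d d' : D R) :
  X d ** Y d' = br X Y (Dscale d d') ** Y d' ** X d.
Proof. apply commutator_iff; apply (proj1 (brP X Y)). Qed.

Lemma br_eq (X Y Z : lie G) :
  (forall d d' : D R, X d ** Y d' = Z (Dscale d d') ** Y d' ** X d) ->
  br X Y = Z.
Proof.
now intros E; apply (proj2 (brP X Y)); intros d d'; apply commutator_iff.
Qed.

Lemma tmap_comm0 (X Y : lie G) (d d' : D R) :
  d * d' = 0 -> X d ** Y d' = Y d' ** X d.
Proof. now intros E; rewrite br_swap, tmap0, gmul1l. Qed.

Lemma br_opp_swap (X Y : lie G) : br Y X = topp (br X Y).
Proof.
apply br_eq; intros d d'; rewrite <- gmulA, (br_swap X Y), !gmulA; cbn.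
rewrite <- (tmapD _ (e := Dscale 0 d)).
- rewrite (tmap0 (br X Y)), gmul1l; [reflexivity | cbn; ring].
- cbn; ring.
Qed.

(** Antisymmetry makes [X,X] its own opposite; splitting d into two halves lets the two factors
    cancel. *)
Lemma br_self (X : lie G) (d : D R) : br X X d = gone.
Proof.
rewrite (tmapD _ (d := Dscale (invn 2) d) (d' := Dscale (invn 2) d)).
- rewrite (br_opp_swap X X) at 1; apply tmapKN.
- cbn; transitivity ((invn 2 + invn 2) * d); [rewrite half_half |]; ring.
Qed.

Lemma tmap_comm (X : lie G) (d d' : D R) : X d ** X d' = X d' ** X d.
Proof. now rewrite br_swap, br_self, gmul1l. Qed.

(** Moving Z_d' left past Y_d and then X_d leaves [Y,Z] and [X,Z] at dd'. These commute with each
    other and the former with X_d, since the products of parameters contain d^2. *)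
Lemma brDl (X Y Z : lie G) : br (X :+ Y) Z = br X Z :+ br Y Z.
Proof.
apply br_eq; intros d d'; cbn.
rewrite <- gmulA, (br_swap Y Z), !gmulA.
rewrite (tmap_comm0 X (br Y Z) (d' := Dscale d d')).
- rewrite <- (gmulA _ (X d)), (br_swap X Z), !gmulA.
  rewrite (tmap_comm0 (br Y Z) (br X Z)); [reflexivity |].
  cbn; ring [(D_sq d)].
- cbn; ring [(D_sq d)].
Qed.

Lemma brNl (X Y : lie G) : br (topp X) Y = topp (br X Y).
Proof.
apply br_eq; intros d d'; cbn; rewrite br_swap.
do 2 f_equal; apply tmap_ext; cbn; ring.
Qed.

End Bracket.

(** * Rewriting of words in a group *)

Lemma gmul_rot (R : line) (G : lieGroup R) (x y z : G) :
  x ** y = z -> forall k, x ** (y ** k) = z ** k.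
Proof. now intros <- k; rewrite gmulA. Qed.

Ltac rot H := rewrite (gmul_rot H); rewrite <- ?gmulA.
Ltac move_left H :=
  match goal with
  | |- context [gmul ?u _] => rewrite (H u) by (cbn; tauto)
  end.

(* The p and q are the third-order brackets [X,[X,Y]] and [Y,[X,Y]] at d1 d2 d3. *)
Lemma collect_word (R : line) (G : lieGroup R)
    (x1 x2 x3 y1 y2 y3 b12 b13 b23 p q : G) :
  x2 ** y1 = b12 ** y1 ** x2 ->
  x3 ** y1 = b13 ** y1 ** x3 ->
  x3 ** y2 = b23 ** y2 ** x3 ->
  x1 ** b12 = b12 ** x1 -> x1 ** b13 = b13 ** x1 -> x1 ** b23 = p ** b23 ** x1 ->
  x2 ** b12 = b12 ** x2 -> x2 ** b23 = b23 ** x2 -> x2 ** b13 = p ** b13 ** x2 ->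
  x3 ** b13 = b13 ** x3 -> x3 ** b23 = b23 ** x3 -> x3 ** b12 = p ** b12 ** x3 ->
  y1 ** b12 = b12 ** y1 -> y1 ** b13 = b13 ** y1 -> y1 ** b23 = q ** b23 ** y1 ->
  y2 ** b12 = b12 ** y2 -> y2 ** b23 = b23 ** y2 -> y2 ** b13 = q ** b13 ** y2 ->
  y3 ** b13 = b13 ** y3 -> y3 ** b23 = b23 ** y3 -> y3 ** b12 = q ** b12 ** y3 ->
  b13 ** b12 = b12 ** b13 -> b23 ** b12 = b12 ** b23 -> b23 ** b13 = b13 ** b23 ->
  q ** p = p ** q ->
  (forall u, In u [x1; x2; x3; y1; y2; y3; b12; b13; b23] ->
     u ** p = p ** u /\ u ** q = q ** u) ->
  x1 ** x2 ** x3 ** (y1 ** y2 ** y3) ** (p ** (q ** q)) =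
  x1 ** y1 ** (x2 ** y2) ** (x3 ** y3) ** (b12 ** b13 ** b23).
Proof.
intros H1 H2 H3 H4 H5 H6 H7 H8 H9 H10 H11 H12 H13 H14 H15 H16 H17 H18
  H19 H20 H21 H22 H23 H24 qp central.
assert (central_p : forall u, In u [x1; x2; x3; y1; y2; y3; b12; b13; b23] ->
  forall k, u ** (p ** k) = p ** (u ** k)).
{ intros u Hu k; destruct (central u Hu) as [E _]; now rewrite !gmulA, E. }
assert (central_q : forall u, In u [x1; x2; x3; y1; y2; y3; b12; b13; b23] ->
  forall k, u ** (q ** k) = q ** (u ** k)).
{ intros u Hu k; destruct (central u Hu) as [_ E]; now rewrite !gmulA, E. }
(* An arbitrary tail [k] lets every relation apply through [gmul_rot], even at the end of a word. *)
match goal with |- ?l = ?r => rewrite <- (gmul1r l), <- (gmul1r r) end.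
generalize (@gone R G) as k; intros k.
rewrite <- !gmulA.
(* The common normal form lists the p, the q, then b12, b13, b23, and finally x1 y1 x2 y2 x3 y3;
   each side collects three p and three q. *)
now repeat first
  [ rot H1 | rot H2 | rot H3 | rot H4 | rot H5 | rot H6 | rot H7 | rot H8
  | rot H9 | rot H10 | rot H11 | rot H12 | rot H13 | rot H14 | rot H15 | rot H16
  | rot H17 | rot H18 | rot H19 | rot H20 | rot H21 | rot H22 | rot H23 | rot H24
  | rot qp | move_left central_p | move_left central_q ].
Qed.

Ltac factors := repeat apply (f_equal2 (@gmul _ _)).

(** * One-parameter subgroups and their exponentials *)

Section Exponential.
Variables (R : line) (G : lieGroup R).
Add Ring Rexp : (ringP R).

(** Moving [phi t] left past [psi s] costs [kap] at 2st, which is exactly the cross term of (s +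
    t)^2. *)
Lemma twisted_one_parameter (phi psi kap gam : R -> G) :
  one_parameter_subgroup phi -> one_parameter_subgroup psi ->
  one_parameter_subgroup kap -> one_parameter_subgroup gam ->
  (forall s t, psi s ** phi t = kap (s * t + s * t) ** phi t ** psi s) ->
  (forall s t, kap s ** phi t = phi t ** kap s) ->
  (forall s t, kap s ** psi t = psi t ** kap s) ->
  (forall s t, gam s ** phi t = phi t ** gam s) ->
  (forall s t, gam s ** psi t = psi t ** gam s) ->
  (forall s t, gam s ** kap t = kap t ** gam s) ->
  one_parameter_subgroup (fun t => phi t ** psi t ** kap (t * t) ** gam t).
Proof.
intros Dphi Dpsi Dkap Dgam H1 H2 H3 H4 H5 H6 s t.
assert (E : (s + t) * (s + t) = (s * t + s * t) + (s * s + t * t)) by ring.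
rewrite E, Dphi, Dpsi, Dkap, (Dkap (s * s)), Dgam, <- !gmulA; f_equal.
rewrite (gmul_rot (H4 s t)), <- !gmulA, (gmul_rot (H5 s t)), <- !gmulA.
rewrite (gmul_rot (H6 s (t * t))), <- !gmulA.
rewrite (gmul_rot (H2 _ t)), <- !gmulA, (gmul_rot (H3 (s * s) t)), <- !gmulA.
rewrite (gmul_rot (H1 s t)), <- !gmulA, (gmul_rot (H2 _ t)), <- !gmulA; f_equal.
now rewrite (gmul_rot (H3 _ s)), <- !gmulA, (gmul_rot (H3 _ t)), <- !gmulA.
Qed.

Variable br : lie G -> lie G -> lie G.
Hypothesis brP : is_lie_bracket br.
Variable exp : lie G -> G.
Hypothesis expP : is_exp exp.

Lemma tscale_one_parameter (X : lie G) (d : D R) :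
  one_parameter_subgroup (fun t => X (Dscale t d)).
Proof. intros s t; apply tscaleD. Qed.

Variables d1 d2 d3 : D R.

(** This replaces X at t(d1 + d2 + d3), which need not lie in D. *)
Definition prod3 (X : lie G) (t : R) : G :=
  X (Dscale t d1) ** X (Dscale t d2) ** X (Dscale t d3).

Lemma prod3_1 (X : lie G) : prod3 X 1 = X d1 ** X d2 ** X d3.
Proof. unfold prod3; factors; apply tmap_ext; cbn; ring. Qed.

Lemma prod3_D (X : lie G) (d : D R) : prod3 X d = X (Dscale (d1 + d2 + d3) d).
Proof.
rewrite !tscaleD; unfold prod3.
factors; apply tmap_ext; cbn; ring.
Qed.

Lemma prod3_one_parameter (X : lie G) : one_parameter_subgroup (prod3 X).
Proof.
intros s t; unfold prod3; rewrite !tscaleD, <- !gmulA; f_equal.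
rewrite (gmul_rot (tmap_comm brP X (Dscale s d3) (Dscale t d1))), <- !gmulA.
rewrite (gmul_rot (tmap_comm brP X (Dscale s d2) (Dscale t d1))), <- !gmulA.
do 2 f_equal.
now rewrite (gmul_rot (tmap_comm brP X (Dscale s d3) (Dscale t d2))), <- !gmulA.
Qed.

Lemma exp_prod3 (X : lie G) :
  exp ((d1 + d2 + d3) *: X) = X d1 ** X d2 ** X d3.
Proof.
rewrite <- prod3_1; apply expP; [apply prod3_one_parameter | apply prod3_D].
Qed.

(** Each of the three factors contributes one z, and these commute with the factors, so they gather
    in front. *)
Lemma prod3_past (X : lie G) (g z : G) (t : R) :
  (forall d, In d [d1; d2; d3] -> g ** X (Dscale t d) = z ** X (Dscale t d) ** g) ->
  (forall d, In d [d1; d2; d3] -> X (Dscale t d) ** z = z ** X (Dscale t d)) ->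
  g ** prod3 X t = z ** z ** z ** prod3 X t ** g.
Proof.
intros H C; unfold prod3.
assert (I1 : In d1 [d1; d2; d3]) by (cbn; tauto).
assert (I2 : In d2 [d1; d2; d3]) by (cbn; tauto).
assert (I3 : In d3 [d1; d2; d3]) by (cbn; tauto).
rewrite <- !gmulA.
rewrite (gmul_rot (H d1 I1)), <- !gmulA, (gmul_rot (H d2 I2)), <- !gmulA.
rewrite (H d3 I3), <- !gmulA.
rewrite (gmul_rot (C d2 I2)), <- !gmulA, !(gmul_rot (C d1 I1)), <- !gmulA.
now rewrite (gmul_rot (C d1 I1)), <- !gmulA.
Qed.

Lemma prod3_comm (X : lie G) (g : G) (t : R) :
  (forall d, In d [d1; d2; d3] -> g ** X (Dscale t d) = X (Dscale t d) ** g) ->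
  g ** prod3 X t = prod3 X t ** g.
Proof.
intros H; rewrite (prod3_past (z := gone)), !gmul1l; try reflexivity.
- now intros d Hd; rewrite gmul1l, H.
- now intros d Hd; rewrite gmul1l, gmul1r.
Qed.

Definition s12 : D R := Dscale d1 d2.
Definition s13 : D R := Dscale d1 d3.
Definition s23 : D R := Dscale d2 d3.
Definition s3 : D R := Dscale d1 s23.

Ltac D_ring := cbn; ring [(D_sq d1) (D_sq d2) (D_sq d3)].

Lemma sigma2_subproof : (d1 * d2 + d1 * d3 + d2 * d3) ^ 2 = 0.
Proof. D_ring. Qed.

Definition s2 : D R := InD sigma2_subproof.

Lemma tmap_sigma2 (X : lie G) : X s2 = X s12 ** X s13 ** X s23.
Proof.
assert (H : (d1 * d2 + d1 * d3) ^ 2 = 0) by D_ring.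
rewrite (tmapD X (d := InD H) (d' := s23)), (tmapD X (d := s12) (d' := s13));
  reflexivity.
Qed.

(** The value -3/2: moving B at s s2 past the three factors of A yields [A,B] at -3st s3, which has
    to equal the cross term 2st m s3. *)
Definition m : R := - (1 + invn 2).

Lemma exp_sigma (A B C : lie G) (c : R) :
  exp ((d1 + d2 + d3) *: A :+ (d1 * d2 + d1 * d3 + d2 * d3) *: B
       :+ (c * d1 * d2 * d3) *: C) =
  A d1 ** A d2 ** A d3 ** B s2 ** br A B (Dscale m s3) ** C (Dscale c s3).
Proof.
pose (K t := br A B (Dscale t (Dscale m s3))).
pose (L t := C (Dscale t (Dscale c s3))).
rewrite (@expP _ (fun t => prod3 A t ** B (Dscale t s2) ** K (t * t) ** L t)).
- rewrite prod3_1; unfold K, L; factors; try reflexivity;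
    apply tmap_ext; cbn; ring.
- apply twisted_one_parameter; try apply tscale_one_parameter;
    try apply prod3_one_parameter; intros s t; unfold K, L.
  (* Two of the three terms of s2 die when multiplied by a given di, leaving d1d2d3 whichever i is
     chosen; hence a single z serves in [prod3_past]. *)
  + assert (Z : forall d, In d [d1; d2; d3] ->
      Dscale (s * s2) (Dscale t d) = Dscale (s * t) s3).
    { intros d [<- | [<- | [<- | []]]]; apply D_ext; D_ring. }
    rewrite (@prod3_past A _ (br B A (Dscale (s * t) s3))); auto.
    * do 2 f_equal; rewrite (br_opp_swap brP A B); cbn.
      rewrite <- (tmapD _ (e := Dscale (- (s * t + s * t)) s3)) by D_ring.
      rewrite <- (tmapD _ (e := Dscale (- (s * t + s * t + s * t)) s3)) by D_ring.
      apply tmap_ext; unfold m; cbn.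
      transitivity (- (s * t + s * t + (invn 2 + invn 2) * (s * t))
        * (d1 * (d2 * d3))); [rewrite half_half|]; ring.
    * intros d Hd; rewrite (br_swap brP B A), <- (Z d Hd); reflexivity.
    * intros d Hd; apply (tmap_comm0 brP).
      destruct Hd as [<- | [<- | [<- | []]]]; D_ring.
  + apply prod3_comm; intros d Hd; apply (tmap_comm0 brP).
    destruct Hd as [<- | [<- | [<- | []]]]; D_ring.
  + apply (tmap_comm0 brP); D_ring.
  + apply prod3_comm; intros d Hd; apply (tmap_comm0 brP).
    destruct Hd as [<- | [<- | [<- | []]]]; D_ring.
  + apply (tmap_comm0 brP); D_ring.
  + apply (tmap_comm0 brP); D_ring.
- intros d; rewrite prod3_D; cbn; unfold K, L.
  (* The quadratic factor is evaluated at d^2 = 0, so it does not affect the tangent vector. *)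
  rewrite (@tmap0 _ _ (br A B)), gmul1r.
  + factors; apply tmap_ext; cbn; ring.
  + cbn; ring [(D_sq d)].
Qed.

Variables X Y : lie G.

(** In [collect_word], b12, b13, b23 become [X,Y] at the didj. A relation is a bracket exchange, or
    a plain commutation when its parameters share some di. *)
Lemma prod3_tadd :
  X d1 ** X d2 ** X d3 ** (Y d1 ** Y d2 ** Y d3) **
    (br X (br X Y) s3 ** (br Y (br X Y) s3 ** br Y (br X Y) s3)) =
  (X :+ Y) d1 ** (X :+ Y) d2 ** (X :+ Y) d3 ** br X Y s2.
Proof.
rewrite tmap_sigma2; apply collect_word;
  try (apply (tmap_comm0 brP); D_ring);
  try (rewrite (br_swap brP); do 2 f_equal; apply tmap_ext; D_ring).
intros u Hu; cbn in Hu.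
repeat destruct Hu as [<- | Hu]; try contradiction;
  split; apply (tmap_comm0 brP); D_ring.
Qed.

Lemma exp_sigma_tadd :
  exp ((d1 + d2 + d3) *: (X :+ Y) :+ (d1 * d2 + d1 * d3 + d2 * d3) *: br X Y
       :+ (invn 2 * d1 * d2 * d3) *: br (X :- Y) (br X Y)) =
  X d1 ** X d2 ** X d3 ** (Y d1 ** Y d2 ** Y d3).
Proof.
(* The appended third-order factor makes [prod3_tadd] applicable; what remains is that all
   third-order terms cancel. *)
apply gmul_cancel_r with
  (br X (br X Y) s3 ** (br Y (br X Y) s3 ** br Y (br X Y) s3)).
rewrite prod3_tadd, exp_sigma, !(brDl brP), (brNl brP).
set (P := br X (br X Y)); set (Q := br Y (br X Y)).
pose (p t := P (Dscale t s3)); pose (q t := Q (Dscale t s3)).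
assert (E1 : (P :+ Q) (Dscale m s3) = p m ** q m) by reflexivity.
assert (E2 : (P :- Q) (Dscale (invn 2) s3) = p (invn 2) ** q (- invn 2)).
{ unfold p, q; cbn; factors; apply tmap_ext; cbn; ring. }
assert (Ep : P s3 = p 1) by (apply tmap_ext; cbn; ring).
assert (Eq : Q s3 = q 1) by (apply tmap_ext; cbn; ring).
assert (pq : forall t u, q t ** p u = p u ** q t).
{ intros t u; apply (tmap_comm0 brP); D_ring. }
rewrite E1, E2, Ep, Eq, <- !gmulA.
rewrite (gmul_rot (pq (- invn 2) _)), <- !gmulA, !(gmul_rot (pq m _)), <- !gmulA.
rewrite (gmul_rot (pq m _)), <- !gmulA.
assert (pD : forall t u, p t ** p u = p (t + u)).
{ intros t u; symmetry; apply tscaleD. }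
assert (qD : forall t u, q t ** q u = q (t + u)).
{ intros t u; symmetry; apply tscaleD. }
rewrite qD, qD, qD, (gmulA (p _)), pD, (gmulA (p _)), pD.
(* The exponents balance: -3/2 - 1/2 + 2 = 0 for Q, and -3/2 + 1/2 + 1 = 0 for P. *)
assert (q0 : q (m + (- invn 2 + (1 + 1))) = gone).
{ apply tmap0; unfold m; cbn.
  transitivity ((1 - (invn 2 + invn 2)) * (d1 * (d2 * d3)));
    [ring | rewrite half_half; ring]. }
assert (p0 : p (m + invn 2 + 1) = gone) by (apply tmap0; unfold m; cbn; ring).
now rewrite p0, q0, gmul1r, gmul1r.
Qed.

Lemma sigma2_half_square :
  (d1 + d2 + d3) ^ 2 * invn 2 = d1 * d2 + d1 * d3 + d2 * d3.
Proof.
transitivity ((invn 2 + invn 2) * (d1 * d2 + d1 * d3 + d2 * d3));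
  [D_ring | rewrite half_half; ring].
Qed.

Lemma sigma3_cube :
  (d1 + d2 + d3) ^ 3 * invn 12 = invn 2 * d1 * d2 * d3.
Proof.
assert (E : natr R 12 * invn 12 = 1) by apply invnP.
(* The cube is 6 d1d2d3; the inserted factor 1/2 + 1/2 turns 6 into 12 times 1/2, so that [invn 12]
   cancels. *)
transitivity ((invn 2 + invn 2) * ((d1 + d2 + d3) ^ 3 * invn 12));
  [rewrite half_half; ring |].
transitivity (natr R 12 * invn 12 * (invn 2 * d1 * d2 * d3));
  [D_ring | rewrite E; ring].
Qed.

End Exponential.

Unset Implicit Arguments.

Theorem theorem41 (R : line) (G : lieGroup R) (Greg : regular G)
    (br : lie G -> lie G -> lie G) (brP : is_lie_bracket br)
    (exp : lie G -> G) (expP : is_exp exp)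
    (X Y : lie G) (d1 d2 d3 : D R) :
  exp ((d1 + d2 + d3) *: X) ** exp ((d1 + d2 + d3) *: Y)
    = exp ((d1 + d2 + d3) *: (X :+ Y)
           :+ (d1 * d2 + d1 * d3 + d2 * d3) *: br X Y
           :+ (invn 2 * d1 * d2 * d3) *: br (X :- Y) (br X Y))
  /\
  exp ((d1 + d2 + d3) *: (X :+ Y)
       :+ (d1 * d2 + d1 * d3 + d2 * d3) *: br X Y
       :+ (invn 2 * d1 * d2 * d3) *: br (X :- Y) (br X Y))
    = exp ((d1 + d2 + d3) *: X
           :+ (d1 + d2 + d3) *: Y
           :+ ((d1 + d2 + d3) ^ 2 * invn 2) *: br X Y
           :+ ((d1 + d2 + d3) ^ 3 * invn 12) *: br (X :- Y) (br X Y)).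
Proof.
split.
- rewrite !(exp_prod3 brP expP).
  symmetry; apply (exp_sigma_tadd brP expP).
- rewrite sigma2_half_square, sigma3_cube; f_equal.
  (* Scaling distributes over [:+] pointwise, by definition of the two operations. *)
  now apply lie_ext.
Qed.
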